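(* Let $k\ge 3$ be an integer. The cycle $C_k$ on $k$ vertices is a shortest path graph if and only if $k$ is even or $k=3$.
   Context: Graphs are finite and simple. For a graph $G$ with distinct vertices $a,b$, a shortest $a,b$-path is a path between $a$ and $b$ of length $d_G(a,b)$. The shortest path graph $S(G,a,b)$ is the graph whose vertices are the shortest $a,b$-paths in $G$, two of them being adjacent if and only if the corresponding paths differ in exactly one vertex. A graph $H$ is called a shortest path graph if there exist a graph $G$ and distinct $a,b\in V(G)$ with $S(G,a,b)\cong H$. *)

(* Defs.v *)
From mathcomp Require Import all_boot.

Set Implicit Arguments.
Unset Strict Implicit.
Unset Printing Implicit Defensive.

Record sgraph := SGraph {
  vertex :> finType;
  adj : rel vertex;
  adj_sym : symmetric adj;
  adj_irrefl : irreflexive adj }.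

Definition isomorphic (G H : sgraph) : Prop :=
  exists f : G -> H, bijective f /\ forall x y : G, adj (f x) (f y) = adj x y.

Section ShortestPaths.
Variables (G : sgraph) (a b : G).

(* [p] lists the vertices following [a], so the path itself is [a :: p] and
   its length (number of edges) is [size p]. *)
Definition is_path (p : seq G) : bool :=
  [&& path (@adj G) a p, last a p == b & uniq (a :: p)].

(* The value is [#|G|] when no path joins [a] to [b]; no path has that length,
   so there are then no shortest paths. *)
Definition dist : nat :=
  find (fun n => [exists p : n.-tuple G, is_path p]) (iota 0 #|G|).

Definition shortest_path := {p : dist.-tuple G | is_path p}.

(* Shortest paths all have the same length, so they are compared position by
   position (a vertex of a shortest path occurs at the position equal to its
   distance from [a], so this agrees with comparing vertex sets). *)
Definition differ_in_one (p q : shortest_path) : bool :=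
  #|[set i : 'I_dist | tnth (val p) i != tnth (val q) i]| == 1.

Lemma differ_in_one_sym : symmetric differ_in_one.
Proof.
move=> p q; congr (#|pred_of_set _| == 1).
by apply/setP => i; rewrite !inE eq_sym.
Qed.

Lemma differ_in_one_irrefl : irreflexive differ_in_one.
Proof.
move=> p; rewrite /differ_in_one (_ : [set i | _] = set0) ?cards0 //.
by apply/setP => i; rewrite !inE eqxx.
Qed.

Definition S_graph : sgraph := SGraph differ_in_one_sym differ_in_one_irrefl.

End ShortestPaths.

Definition is_shortest_path_graph (H : sgraph) : Prop :=
  exists (G : sgraph) (a b : G), a != b /\ isomorphic (S_graph a b) H.

(* [ordS i] is [i + 1] modulo [k]; the conjunct [i != j] only matters for
   [k = 1]. *)
Definition cycle_adj (k : nat) : rel 'I_k :=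
  fun i j => (i != j) && ((ordS i == j) || (ordS j == i)).

Lemma cycle_adj_sym k : symmetric (@cycle_adj k).
Proof. by move=> i j; rewrite /cycle_adj eq_sym orbC. Qed.

Lemma cycle_adj_irrefl k : irreflexive (@cycle_adj k).
Proof. by move=> i; rewrite /cycle_adj eqxx. Qed.

Definition cycle_graph (k : nat) : sgraph :=
  SGraph (@cycle_adj_sym k) (@cycle_adj_irrefl k).

(* Main.v *)
(** Odd cycles of length at least five are excluded by parity.  Label each edge
    of the cycle by the unique position at which its two end paths differ.  Two
    consecutive edges with equal labels would span a triangle; two consecutive
    edges with labels at distance at least two can be performed in the other
    order, which gives their end paths a second common neighbour and hence a
    4-cycle.  So the labels of consecutive edges differ by one, and a closed
    walk on the integers has even length.

    Conversely, when [d(a,b) = 3] the shortest path graph is the line graph of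
    the bipartite graph between the two middle layers, and an even cycle is its
    own line graph; the triangle comes from [K_{2,3}]. *)
Require Import Defs.
From mathcomp Require Import all_boot.

Set Implicit Arguments.
Unset Strict Implicit.
Unset Printing Implicit Defensive.

(** * Walks of minimal length and recognition of [S_graph] *)

(** Shortening the walk leaves a simple path on some of its vertices. That path has fewer than
    [#|G|] edges, so the [find] in [dist] ranges over its length. *)
Lemma dist_leq_walk (G : sgraph) (a b : G) (p : seq G) :
  path (@adj G) a p -> last a p = b -> dist a b <= size p.
Proof.
move=> pth; case: (shortenP pth) => q pth_q uniq_q sub_qp lst.
rewrite -(size_map id p) map_id.
have q_is_path : is_path a b (in_tuple q).
  by rewrite /is_path pth_q uniq_q lst eqxx.
have lt_q : size q < #|G|.
  by have := max_card [in a :: q]; rewrite (card_uniqP uniq_q).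
apply: leq_trans (uniq_leq_size _ sub_qp); last by case/andP: uniq_q.
rewrite leqNgt; apply/negP => /(before_find 0); rewrite nth_iota // add0n.
by case/existsP; exists (in_tuple q).
Qed.

(** A repeated vertex could be cut out, leaving a walk shorter than [dist a b]. *)
Lemma walk_is_path (G : sgraph) (a b : G) (p : (dist a b).-tuple G) :
  path (@adj G) a p -> last a p = b -> is_path a b p.
Proof.
move=> pth lst; rewrite /is_path pth lst eqxx /=.
move: lst; case: (shortenP pth) => q pth_q uniq_q sub_qp lst.
have le_q := dist_leq_walk pth_q lst.
have uq : uniq q by case/andP: uniq_q.
have le_pq : size p <= size q by rewrite size_tuple.
have [_ eq_qp] := uniq_min_size uq sub_qp le_pq.
move: uniq_q => /= /andP[aq _]; rewrite -eq_qp aq.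
by rewrite (leq_size_uniq uq sub_qp le_pq).
Qed.

Lemma dist_eq (G : sgraph) (a b : G) n (p : n.-tuple G) :
  is_path a b p ->
  (forall q : seq G, size q < n -> ~~ is_path a b q) -> dist a b = n.
Proof.
move=> pP min_n; have /and3P[pth /eqP lst uniq_p] := pP.
apply/eqP; rewrite eqn_leq -{1}(size_tuple p) dist_leq_walk //=.
rewrite leqNgt; apply/negP => lt_n.
have lt_G : n < #|G|.
  by have := max_card [in a :: p]; rewrite (card_uniqP uniq_p) /= size_tuple.
have : has (fun m => [exists q : m.-tuple G, is_path a b q]) (iota 0 #|G|).
  rewrite has_find size_iota; exact: ltn_trans lt_G.
move/(nth_find 0); rewrite -/(dist a b) nth_iota ?(ltn_trans lt_n) //.
by case/existsP => q; apply/negP/min_n; rewrite size_tuple.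
Qed.

(** Keeping [n] free lets concrete graphs work with tuples of literal length; the path [F h0] and
    minimality identify [n] with [dist a b]. *)
Lemma S_graph_isomorphic (G H : sgraph) (a b : G) n (h0 : H)
    (F : H -> n.-tuple G) :
  injective F ->
  (forall h, is_path a b (F h)) ->
  (forall p : n.-tuple G, is_path a b p -> exists h, F h = p) ->
  (forall q : seq G, size q < n -> ~~ is_path a b q) ->
  (forall x y, adj x y = (#|[set i | tnth (F x) i != tnth (F y) i]| == 1)) ->
  isomorphic (S_graph a b) H.
Proof.
move=> injF FP surjF min_n adjF; have eqn := dist_eq (FP h0) min_n.
subst n.
have exF (p : S_graph a b) : exists h, F h == val p.
  by have [h <-] := surjF _ (valP p); exists h.
pose f (p : S_graph a b) := xchoose (exF p).
have fK p : F (f p) = val p by apply/eqP/(xchooseP (exF p)).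
exists f; split; last by move=> p q; rewrite adjF !fK.
exists (fun h => exist _ (F h) (FP h)) => [p|h]; first by apply/val_inj/fK.
by apply: injF; rewrite fK.
Qed.

Section Layered.
Variables (T : finType) (A B : pred T) (e : rel T).
Hypotheses (e_sym : symmetric e) (e_irrefl : irreflexive e).

(** [inl true] serves as the source, joined to [A], and [inl false] as the target, joined to [B]. *)
Definition layered_adj : rel (bool + T) := fun x y =>
  match x, y with
  | inl c, inr i | inr i, inl c => if c then A i else B i
  | inr i, inr j => e i j
  | _, _ => false
  end.

Lemma layered_adj_sym : symmetric layered_adj.
Proof. by move=> [c|i] [c'|j] //=; apply: e_sym. Qed.

Lemma layered_adj_irrefl : irreflexive layered_adj.
Proof. by move=> [c|i] //=; apply: e_irrefl. Qed.

Definition layered : sgraph := SGraph layered_adj_sym layered_adj_irrefl.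

End Layered.

(** * Counting and successor arithmetic on the cycle *)

Lemma card_ord_set n (P : pred 'I_n) : #|[set i | P i]| = \sum_(i < n) P i.
Proof. by rewrite cardsE -sum1_card big_mkcond. Qed.

Lemma val_ordS k (i : 'I_k) : ordS i = (if i.+1 == k then 0 else i.+1) :> nat.
Proof.
case: eqP => [eqk|nek] /=; first by rewrite eqk modnn.
by rewrite modn_small // ltn_neqAle ltn_ord andbT; apply/eqP.
Qed.

Lemma iter_ordS_eq k n (i : 'I_k) : (iter n (@ordS k) i == i) = (k %| n).
Proof.
have val_iter m : iter m (@ordS k) i = (i + m) %% k :> nat.
  elim: m => [|m IHm]; first by rewrite addn0 modn_small.
  by rewrite iterS /= IHm -addn1 modnDml addn1 addnS.
rewrite -(inj_eq (@ord_inj k)) val_iter -[X in _ == X](modn_small (ltn_ord i)).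
by rewrite -[X in _ == X %[mod k]]addn0 eqn_modDl mod0n.
Qed.

Lemma cycle_adjE k (i j : 'I_k) : 1 < k ->
  cycle_adj i j = (ordS i == j) || (ordS j == i).
Proof.
move=> k1; rewrite /cycle_adj; have [<-|//] := eqVneq i j.
by rewrite (iter_ordS_eq 1) dvdn1 gtn_eqF.
Qed.

(** A second common neighbour would be both [t - 1] and [t + 3], forcing [k] to divide 4. *)
Lemma cycle_common_neighbor k (t w : 'I_k) : 4 < k ->
  cycle_adj w t -> cycle_adj w (ordS (ordS t)) -> w = ordS t.
Proof.
move=> k4; have k1 : 1 < k by do 3!apply: ltnW.
rewrite !cycle_adjE // => /orP[/eqP <-|/eqP <- //].
case/orP => [|fix4]; first by rewrite (inj_eq (@ordS_inj k)) => /eqP.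
by move: (iter_ordS_eq 4 w); rewrite /= fix4 gtnNdvd.
Qed.

(** * Realizing the triangle and the even cycles *)

Lemma triangle_shortest_path_graph : is_shortest_path_graph (cycle_graph 3).
Proof.
have sym0 : symmetric (fun _ _ : 'I_3 => false) by [].
have irr0 : irreflexive (fun _ _ : 'I_3 => false) by [].
(* Three independent middle vertices joined to both ends form K_{2,3}; a path is its middle vertex,
   so any two paths differ exactly there. *)
pose G := layered predT predT sym0 irr0.
exists G, (inl true), (inl false); split => //.
pose F (i : 'I_3) : 2.-tuple G := [tuple inr i; inl false].
apply: (@S_graph_isomorphic _ (cycle_graph 3) _ _ 2 ord0 F).
- by move=> i j [].
- by [].
- case=> [[|[c|i] [|y [|? ?]]] //= sz].
  by case/and3P=> [_ /= /eqP eqy _]; exists i; apply: val_inj; rewrite /= eqy.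
- by move=> [|[c|i] [|//]].
move=> i j; rewrite card_ord_set !big_ord_recl big_ord0 !(tnth_nth (inl true)) /=.
rewrite cycle_adjE // !addn0 eqb1 (inj_eq inr_inj).
by case: i j => [[|[|[|//]]] ?] [[|[|[|//]]] ?].
Qed.

Lemma even_cycle_shortest_path_graph k :
  2 < k -> ~~ odd k -> is_shortest_path_graph (cycle_graph k).
Proof.
move=> k2 evk; have k1 : 1 < k by apply: ltnW.
(* The source sees the even vertices of the cycle and the target the odd ones, so paths of length
   three correspond to edges of the cycle. *)
pose G := layered (fun i : 'I_k => ~~ odd i) (fun i => odd i)
                  (@cycle_adj_sym k) (@cycle_adj_irrefl k).
exists G, (inl true), (inl false); split => //.
(* Evenness of [k] enters at the wrap-around from [k - 1] to 0. *)
have odd_ordS (i : 'I_k) : odd (ordS i) = ~~ odd i.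
  rewrite val_ordS; case: eqP => // eqk; have : ~~ odd i.+1 by rewrite eqk.
  by rewrite /= => /negbNE ->.
(* The even and odd ends of the edge from [i] to [ordS i]. *)
pose ev (i : 'I_k) := if odd i then ordS i else i.
pose od (i : 'I_k) := if odd i then i else ordS i.
pose F (i : 'I_k) : 3.-tuple G := [tuple inr (ev i); inr (od i); inl false].
have ordSS (i : 'I_k) : ordS (ordS i) != i.
  by rewrite (iter_ordS_eq 2) gtnNdvd.
apply: (@S_graph_isomorphic _ (cycle_graph k) _ _ 3
          (Ordinal (leq_trans (isT : 0 < 3) k2)) F).
- move=> i j []; rewrite /ev /od.
  case oi: (odd i); case oj: (odd j) => // eq1 eq2.
    by have := ordSS j; rewrite -eq2 eq1 eqxx.
  by have := ordSS j; rewrite -eq1 eq2 eqxx.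
- move=> i; have neqS : (ordS i == i) = false.
    by apply/eqP => eqi; move: (odd_ordS i); rewrite eqi; case: odd.
  rewrite /is_path /= !inE /= /ev /od.
  case oi: (odd i); rewrite /= ?odd_ordS oi /= cycle_adjE // eqxx ?orbT /=.
    by rewrite (inj_eq inr_inj) neqS.
  by rewrite (inj_eq inr_inj) eq_sym neqS.
- case=> [[|x [|y [|z [|? ?]]]] //= sz].
  case/and3P=> pth /eqP /= zb _; move: pth; rewrite {z}zb in sz *.
  case: x sz => [[]|i] sz; case: y sz => [[]|j] sz //=; try by case/and3P.
  case/and4P=> /= evi eij oj _.
  move: eij; rewrite cycle_adjE // => /orP[] /eqP eqS; [exists i|exists j];
    by apply: val_inj; rewrite /= /ev /od ?(negPf evi) ?oj eqS.
(* In a path of length two the middle vertex would be both even and odd. *)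
- case=> [|x [|y [|? ?]]] // _; apply/and3P => -[/= pth /eqP /= lst _].
    by rewrite lst in pth.
  by rewrite lst in pth; case: x pth => [[]|i] /and3P[] //= /negPf ->.
move=> i j; rewrite card_ord_set !big_ord_recl big_ord0 !(tnth_nth (inl true)) /=.
rewrite !(inj_eq inr_inj) cycle_adjE // /ev /od.
have neq_par (u v : 'I_k) : odd u = odd v -> (ordS u == v) = false.
  by move=> uv; apply/eqP => eqv; move: (odd_ordS u); rewrite eqv uv; case: odd.
(* For equal parities both inner entries agree or both differ. For opposite parities an entry agrees
   exactly when one index succeeds the other, and [ordSS] forbids this both ways at once. *)
case oi: (odd i); case oj: (odd j) => /=.
- rewrite (neq_par i j) ?(neq_par j i) ?oi ?oj // (inj_eq (@ordS_inj k)).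
  by case: (i == j).
- rewrite (eq_sym i (ordS j)); case: (ordS i =P j) => [<-|_]; last by case: eqP.
  by rewrite (negPf (ordSS _)).
- rewrite (eq_sym i (ordS j)); case: (ordS i =P j) => [<-|_]; last by case: eqP.
  by rewrite (negPf (ordSS _)).
rewrite (neq_par i j) ?(neq_par j i) ?oi ?oj // (inj_eq (@ordS_inj k)).
by case: (i == j).
Qed.

(** * Commuting two distant changes, and the parity obstruction *)

(** Since [i] and [j] are neither equal nor consecutive, no edge of [r] meets both positions, so
    each is an edge of [p] or of [q]. *)
Lemma path_splice (G : sgraph) (a b : G) (p q r : seq G) n i j :
  size p = n -> size q = n -> size r = n ->
  path (@adj G) a p -> path (@adj G) a q ->
  last a p = b -> last a q = b ->
  i != j -> i != j.+1 -> j != i.+1 ->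
  (forall m, m != j -> nth a r m = nth a p m) ->
  (forall m, m != i -> nth a r m = nth a q m) ->
  path (@adj G) a r /\ last a r = b.
Proof.
move=> szp szq szr /(pathP a) pp /(pathP a) pq lp lq ij iSj jSi rp rq; split.
  apply/(pathP a) => m; rewrite szr => lt_m.
  have eqC s m' : (forall m, m != m' -> nth a r m = nth a s m) -> m != m'.+1 ->
      nth a (a :: r) m = nth a (a :: s) m.
    by case: m {lt_m} => //= m eq_rs; rewrite eqSS => /eq_rs.
  (* Edge [m] joins entries [m - 1] and [m] of [r] (entry -1 being [a]), so it meets position [j]
     only if [m] is [j] or [j.+1]. *)
  have [near_j|] := boolP ((m == j) || (m == j.+1)); last first.
    rewrite negb_or => /andP[mj mSj].
    by rewrite (eqC _ _ rp) // rp //; apply: pp; rewrite szp.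
  rewrite (eqC _ _ rq) ?rq //; first by apply: pq; rewrite szq.
    by case/orP: near_j => /eqP ->; rewrite // eq_sym.
  by case/orP: near_j => /eqP ->; rewrite // eqSS eq_sym.
move: lp lq; rewrite -!(nth_last a) szp szq szr.
by have [->|/rp ->//] := eqVneq n.-1 j; rewrite rq // eq_sym.
Qed.

Lemma nth_eq_off (T : Type) n (x0 : T) (x y : n.-tuple T) (l : 'I_n) :
  (forall m, m != l -> tnth x m = tnth y m) ->
  forall m : nat, m != l -> nth x0 x m = nth x0 y m.
Proof.
move=> eqxy m neq_ml; have [lt_m|le_m] := ltnP m n; last first.
  by rewrite !nth_default ?size_tuple.
by have := eqxy (Ordinal lt_m) neq_ml; rewrite !(tnth_nth x0).
Qed.

Lemma odd_cycle_not_shortest_path_graph k :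
  4 < k -> odd k -> ~ is_shortest_path_graph (cycle_graph k).
Proof.
move=> k4 oddk; have k1 : 1 < k by do 3!apply: ltnW.
move=> [G [a [b [_ [f [[g fK gK] fadj]]]]]].
have gadj t u : differ_in_one (g t) (g u) = cycle_adj t u.
  by rewrite -[in RHS](gK t) -[in RHS](gK u); apply/esym/fadj.
have labP (t : 'I_k) : exists i : 'I_(dist a b),
    [set j | tnth (val (g t)) j != tnth (val (g (ordS t))) j] == [set i].
  have : differ_in_one (g t) (g (ordS t)) by rewrite gadj cycle_adjE // eqxx.
  by case/cards1P => i ->; exists i.
pose lab t := xchoose (labP t).
have labE t j : (tnth (val (g t)) j != tnth (val (g (ordS t))) j) = (j == lab t).
  by have /eqP/setP/(_ j) := xchooseP (labP t); rewrite !inE.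
have lab_odd t : odd (lab (ordS t)) = ~~ odd (lab t).
  set u := ordS t; set v := ordS u; set i := lab t; set j := lab u.
  have [neq_tv not_adj_tv] : t != v /\ ~~ cycle_adj t v.
    rewrite cycle_adjE // (inj_eq (@ordS_inj k)) !(eq_sym t).
    by rewrite (iter_ordS_eq 2) (iter_ordS_eq 1) (iter_ordS_eq 3)
      !gtnNdvd // ltnW // ltnW.
  have eqPQ n : n != i -> tnth (val (g t)) n = tnth (val (g u)) n.
    by rewrite -labE negbK => /eqP.
  have eqQR n : n != j -> tnth (val (g u)) n = tnth (val (g v)) n.
    by rewrite -labE negbK => /eqP.
  (* With equal labels, the paths of [t] and [v] would differ only at [i], making [t] and [v]
     adjacent. *)
  have neq_ij : i != j.
    apply: contra not_adj_tv => /eqP eq_ij; rewrite -gadj.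
    apply/cards1P; exists i; apply/setP => n; rewrite !inE.
    have [->|neq_ni] := eqVneq n i; last by rewrite eqPQ // eqQR -?eq_ij // eqxx.
    apply: contraNneq neq_tv => eq_i; apply/eqP.
    apply: (can_inj gK); apply/val_inj/eq_from_tnth => n'.
    have [->//|neq_n'i] := eqVneq n' i.
    by rewrite eqPQ // eqQR // -eq_ij.
  apply/eqP; rewrite -[_ == _]negbK; apply/negP => par.
  have neq_ij_nat : (i : nat) != j by rewrite (inj_eq (@ord_inj _)).
  (* The two changes in reverse order: [j] is altered first, while [i] keeps its old vertex. *)
  pose r := [tuple if n == j then tnth (val (g v)) n else tnth (val (g t)) n
            | n < dist a b].
  have rj : tnth r j = tnth (val (g v)) j by rewrite tnth_mktuple eqxx.
  have rP n : n != j -> tnth r n = tnth (val (g t)) n.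
    by rewrite tnth_mktuple => /negPf ->.
  have rR n : n != i -> tnth r n = tnth (val (g v)) n.
    rewrite tnth_mktuple; have [//|neq_nj] := eqVneq n j => neq_ni.
    by rewrite eqPQ // eqQR.
  have [pth_t /eqP last_t _] := and3P (valP (g t)).
  have [pth_v /eqP last_v _] := and3P (valP (g v)).
  have walk_r : path (@adj G) a r /\ last a r = b.
    (* Equal parity, from [par], rules out consecutive positions. *)
    apply: (path_splice (n := dist a b) _ _ _ pth_t pth_v last_t last_v
              neq_ij_nat _ _ (nth_eq_off _ rP) (nth_eq_off _ rR));
      rewrite ?size_tuple //; apply: contraNneq par => ->; rewrite /= ?negbK //.
  pose w : S_graph a b := exist _ r (walk_is_path walk_r.1 walk_r.2).
  have adj_wt : cycle_adj (f w) t.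
    rewrite -gadj fK; apply/cards1P; exists j; apply/setP => n; rewrite !inE /=.
    have [->|neq_nj] := eqVneq n j; last by rewrite rP ?eqxx.
    by rewrite rj (eqPQ j) 1?(eq_sym j) // (eq_sym (tnth _ _)) labE eqxx.
  have adj_wv : cycle_adj (f w) v.
    rewrite -gadj fK; apply/cards1P; exists i; apply/setP => n; rewrite !inE /=.
    have [->|neq_ni] := eqVneq n i; last by rewrite rR ?eqxx.
    by rewrite rP // -eqQR // labE eqxx.
  have eq_wu : f w = u by apply: cycle_common_neighbor k4 adj_wt adj_wv.
  (* Uniqueness of the common neighbour makes [r] the path of [u], yet [r] agrees with the path of
     [t] at [i], where [u] differs. *)
  have := labE t i; rewrite eqxx -/u -eq_wu fK /= rP //.
  by rewrite eqxx.
have lab_iter n t : odd (lab (iter n (@ordS k) t)) = odd n (+) odd (lab t).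
  by elim: n => //= n IHn; rewrite lab_odd IHn addNb.
(* One full turn returns to [t0] after an odd number of parity flips. *)
pose t0 : 'I_k := Ordinal (leq_trans (isT : 0 < 5) k4).
have := lab_iter k t0; rewrite (eqP (_ : iter k _ t0 == t0)) ?iter_ordS_eq //.
by rewrite oddk; case: (odd _).
Qed.

Theorem theorem18 (k : nat) (hk : 3 <= k) :
  is_shortest_path_graph (cycle_graph k) <-> ~~ odd k \/ k = 3.
Proof.
split=> [spg|[evk|->]].
- case oddk: (odd k); last by left.
  right; apply/eqP; rewrite eqn_leq hk andbT leqNgt; apply/negP => k3.
  apply: odd_cycle_not_shortest_path_graph spg => //.
  by rewrite ltn_neqAle k3 andbT; apply: contraTneq oddk => <-.
- exact: even_cycle_shortest_path_graph.
- exact: triangle_shortest_path_graph.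
Qed.
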